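(* Let $(X,d)$ be a bicomplete quasi-pseudometric space. Let $F:X\to CB(X)$ be a set-valued map that satisfies $H(Fx,Fy)\le\psi(d(x,y))$ for each $x,y\in X$, where $\psi:[0,\infty)\to[0,\infty)$ is upper semicontinuous, $\psi(t)<t$ for each $t>0$, and $\liminf_{t\to\infty}(t-\psi(t))>0$. Then there exists a unique $x_0\in X$ which is both a startpoint and an endpoint of $F$ if and only if $F$ has the approximate mix-point property.
   Context: A quasi-pseudometric on a nonempty set $X$ is a function $d:X\times X\to[0,\infty)$ with $d(x,x)=0$ and $d(x,z)\le d(x,y)+d(y,z)$ for all $x,y,z\in X$. It is a $T_0$-quasi-pseudometric if moreover $d(x,y)=0=d(y,x)$ implies $x=y$; then $d^s(x,y)=\max\{d(x,y),d(y,x)\}$ is a metric. $(X,d)$ is bicomplete if $d$ is a $T_0$-quasi-pseudometric and the metric $d^s$ is complete. A subset $A\subseteq X$ is bounded if there is $M>0$ with $d(x,y)<M$ for all $x,y\in A$. $CB(X)$ is the collection of all nonempty bounded subsets of $X$ that are closed with respect to the topology $\tau(d^s)$ of $d^s$. For nonempty $A,B\subseteq X$ and $x\in X$: $d(x,A)=\inf_{a\in A}d(x,a)$, $d(A,x)=\inf_{a\in A}d(a,x)$, and $H(A,B)=\max\{\sup_{a\in A}d(a,B),\ \sup_{b\in B}d(A,b)\}$. A point $x\in X$ is a startpoint of $F$ if $H(\{x\},Fx)=0$, and an endpoint of $F$ if $H(Fx,\{x\})=0$. $F$ has the approximate mix-point property if $\inf_{x\in X}\sup_{y\in Fx}d^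s(x,y)=0$.
   Formalization: The formal theorem additionally assumes ψ(0)=0; without it the claim fails, e.g. X=[0,1], d(x,y)=max(y−x,0), Fx={x/2} for x>0, F0={0,1}, ψ(0)=5, ψ(t)=t/2 for t>0. *)

(* Defs.v *)
From HB Require Import structures.
From mathcomp Require Import all_boot all_order all_algebra.
From mathcomp Require Import boolp classical_sets reals ereal topology normedtype.

Set Implicit Arguments.
Unset Strict Implicit.
Unset Printing Implicit Defensive.

Import Order.TTheory GRing.Theory Num.Theory.
Import numFieldNormedType.Exports.

Local Open Scope classical_set_scope.
Local Open Scope ring_scope.

Definition quasi_pseudometric (R : realType) (X : Type) (d : X -> X -> R) :=
  [/\ forall x y, 0 <= d x y,
      forall x, d x x = 0
    & forall x y z, d x z <= d x y + d y z].

Definition T0_quasi_pseudometric (R : realType) (X : Type) (d : X -> X -> R) :=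
  quasi_pseudometric d /\ (forall x y, d x y = 0 -> d y x = 0 -> x = y).

Definition dsym (R : realType) (X : Type) (d : X -> X -> R) (x y : X) : R :=
  Num.max (d x y) (d y x).

(* The set X carrying the metric d^s, hence the topology tau(d^s) and the
   uniformity of d^s. *)
Definition symspace (R : realType) (X : pointedType) (d : X -> X -> R)
  (dT0 : T0_quasi_pseudometric d) : Type := X.

HB.instance Definition _ (R : realType) (X : pointedType) (d : X -> X -> R)
  (dT0 : T0_quasi_pseudometric d) := Pointed.copy (symspace dT0) X.

Section symspace_metric.
Context (R : realType) (X : pointedType) (d : X -> X -> R).
Variable dT0 : T0_quasi_pseudometric d.

Let dsymxx (x : symspace dT0) : dsym d x x = 0.
Proof. by have [[_ dxx _] _] := dT0; rewrite /dsym maxxx dxx. Qed.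

Let dsym_positivity (x y : symspace dT0) : dsym d x y = 0 -> x = y.
Proof.
move=> xy0; have [[d0 _ _] dsep] := dT0.
have dxy0 : d x y <= 0 by rewrite -xy0 le_max lexx.
have dyx0 : d y x <= 0 by rewrite -xy0 le_max lexx orbT.
by apply: dsep; apply/eqP; rewrite eq_le d0 ?dxy0 ?dyx0.
Qed.

Let dsymC (x y : symspace dT0) : dsym d x y = dsym d y x.
Proof. by rewrite /dsym maxC. Qed.

Let dsym_triangle (y x z : symspace dT0) :
  dsym d x z <= dsym d x y + dsym d y z.
Proof.
have [[_ _ dtri] _] := dT0; rewrite /dsym ge_max; apply/andP; split.
  by apply: le_trans (dtri _ y _) _; rewrite lerD// le_max lexx.
by apply: le_trans (dtri _ y _) _; rewrite addrC lerD// le_max lexx orbT.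
Qed.

HB.instance Definition _ := @isMetric.Build R (symspace dT0) (dsym d)
  dsymxx dsym_positivity dsymC dsym_triangle.

End symspace_metric.

(* Same condition as in the structure completeType, as a predicate. *)
Definition bicomplete (R : realType) (X : pointedType) (d : X -> X -> R)
    (dT0 : T0_quasi_pseudometric d) :=
  forall G : set_system (symspace dT0), ProperFilter G -> cauchy G -> cvg G.

Definition qbounded (R : realType) (X : Type) (d : X -> X -> R) (A : set X) :=
  exists2 M : R, 0 < M & forall x y, A x -> A y -> d x y < M.

Definition CB (R : realType) (X : pointedType) (d : X -> X -> R)
    (dT0 : T0_quasi_pseudometric d) : set (set X) :=
  [set A | [/\ A !=set0, qbounded d A & closed (A : set (symspace dT0))]].

(* Infima and suprema are taken in \bar R, where they always exist. *)

Definition dist_pt_set (R : realType) (X : Type) (d : X -> X -> R)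
    (x : X) (A : set X) : \bar R :=
  ereal_inf [set (d x a)%:E | a in A].

Definition dist_set_pt (R : realType) (X : Type) (d : X -> X -> R)
    (A : set X) (x : X) : \bar R :=
  ereal_inf [set (d a x)%:E | a in A].

Definition hausdorff (R : realType) (X : Type) (d : X -> X -> R)
    (A B : set X) : \bar R :=
  Order.max (ereal_sup [set dist_pt_set d a B | a in A])
            (ereal_sup [set dist_set_pt d A b | b in B]).

Definition startpoint (R : realType) (X : Type) (d : X -> X -> R)
    (F : X -> set X) (x : X) :=
  hausdorff d [set x] (F x) = 0%E.

Definition endpoint (R : realType) (X : Type) (d : X -> X -> R)
    (F : X -> set X) (x : X) :=
  hausdorff d (F x) [set x] = 0%E.

Definition approx_mix_point (R : realType) (X : Type) (d : X -> X -> R)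
    (F : X -> set X) :=
  ereal_inf [set ereal_sup [set (dsym d x y)%:E | y in F x] | x in setT] = 0%E.

Definition upper_semicontinuous (T : topologicalType) (R : numFieldType)
    (f : T -> R) :=
  forall x a, f x < a -> \forall y \near x, f y < a.

(* A function [0, +oo[ -> [0, +oo[ is a function R -> R whose properties are
   only required on [0, +oo[; semicontinuity refers to the subspace topology. *)
Definition usc_on_nonneg (R : realType) (psi : R -> R) :=
  upper_semicontinuous (psi : subspace `[0, +oo[%classic -> R).

(* Main.v *)
(* A point is both a startpoint and an endpoint of F exactly when F x = {x}.
   Given the approximate mix-point property, the sets S_e of points x whose
   image F x lies within e of x are nonempty and form a filter base. Upper
   semicontinuity on compact intervals and the condition at infinity bound
   t - psi t below by a positive constant on each [e, +oo[, and points x, y of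
   S_c satisfy d x y < psi (d x y) + 3 c, so the filter is Cauchy for d^s. As F
   is nonexpansive, its limit x satisfies F x = {x}. *)

Require Import Defs.
From mathcomp Require Import all_boot all_order all_algebra.
From mathcomp Require Import lra.
From mathcomp Require Import boolp classical_sets reals ereal topology normedtype.

Set Implicit Arguments.
Unset Strict Implicit.
Unset Printing Implicit Defensive.

Import Order.TTheory GRing.Theory Num.Theory.
Import numFieldNormedType.Exports.

Local Open Scope classical_set_scope.
Local Open Scope ring_scope.

Section hausdorff_lemmas.
Context (R : realType) (X : Type) (d : X -> X -> R).
Implicit Types (A B : set X) (F : X -> set X).

(** The infimum behind [dist_pt_set] need not be attained, so a witness [b] costs the slack
    [r < s]. *)
Lemma hausdorff_le_fwd A B r s a : (hausdorff d A B <= r%:E)%E -> r < s -> A a ->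
  exists2 b, B b & d a b < s.
Proof.
rewrite /hausdorff ge_max => /andP[+ _] rs Aa.
move=> /ereal_supP/(_ _ (imageP _ Aa)) aB.
have : (dist_pt_set d a B < s%:E)%E by apply: le_lt_trans aB _; rewrite lte_fin.
by move=> /ereal_inf_lt[_ [b Bb <-]]; rewrite lte_fin => ?; exists b.
Qed.

Lemma hausdorff_le_bwd A B r s b : (hausdorff d A B <= r%:E)%E -> r < s -> B b ->
  exists2 a, A a & d a b < s.
Proof.
rewrite /hausdorff ge_max => /andP[_ +] rs Bb.
move=> /ereal_supP/(_ _ (imageP _ Bb)) Ab.
have : (dist_set_pt d A b < s%:E)%E by apply: le_lt_trans Ab _; rewrite lte_fin.
by move=> /ereal_inf_lt[_ [a Aa <-]]; rewrite lte_fin => ?; exists a.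
Qed.

Lemma hausdorff_set1 x y : hausdorff d [set x] [set y] = (d x y)%:E.
Proof.
rewrite /hausdorff /dist_pt_set /dist_set_pt.
by rewrite !image_set1 !ereal_inf1 !ereal_sup1 maxxx.
Qed.

(** For [y] in [F x], the startpoint condition forces [d x y = 0] and the endpoint condition
    [d y x = 0]; the separation axiom then gives [x = y]. *)
Lemma start_endpointP F x : T0_quasi_pseudometric d -> F x !=set0 ->
  (startpoint d F x /\ endpoint d F x) <-> F x = [set x].
Proof.
move=> [[d0 dxx _] dsep] Fx0; split=> [[sx ex]|Fx].
  have Fx y : F x y -> x = y.
    move=> Fxy; apply: dsep; apply/eqP; rewrite eq_le d0 andbT.
      apply/ler_addgt0Pl => e e0; rewrite addr0.
      by have [|_ -> /ltW] := @hausdorff_le_bwd [set x] (F x) 0 e y _ e0 Fxy; rewrite ?sx.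
    apply/ler_addgt0Pl => e e0; rewrite addr0.
    by have [|_ -> /ltW] := @hausdorff_le_fwd (F x) [set x] 0 e y _ e0 Fxy; rewrite ?ex.
  apply/seteqP; split=> [y /Fx ->//|_ ->].
  by have [y Fxy] := Fx0; rewrite {2}(Fx _ Fxy).
by rewrite /startpoint /endpoint Fx hausdorff_set1 dxx.
Qed.

Lemma approx_mix_point_ex F e : approx_mix_point d F -> 0 < e ->
  exists x, forall y, F x y -> dsym d x y < e.
Proof.
move=> inf0 e0.
have /ereal_inf_lt[_ [x _ <-] supe] :
    (ereal_inf [set ereal_sup [set (dsym d x y)%:E | y in F x] | x in setT] < e%:E)%E.
  by rewrite [X in (X < _)%E]inf0 lte_fin.
exists x => y Fxy; rewrite -lte_fin; apply: le_lt_trans supe.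
exact/ereal_sup_ubound/imageP.
Qed.

Lemma fixed_approx_mix_point F x : quasi_pseudometric d -> (forall z, F z !=set0) ->
  F x = [set x] -> approx_mix_point d F.
Proof.
move=> [d0 dxx _] F0 Fx; apply/eqP; rewrite eq_le; apply/andP; split.
  apply: ge_ereal_inf; exists (ereal_sup [set (dsym d x y)%:E | y in F x]).
    by exists x.
  by rewrite Fx image_set1 ereal_sup1 /dsym maxxx dxx.
apply: le_ereal_inf_tmp => _ [z _ <-]; have [y Fzy] := F0 z.
apply: le_ereal_sup_tmp; exists (dsym d z y)%:E; first exact: imageP.
by rewrite lee_fin /dsym le_max d0.
Qed.

End hausdorff_lemmas.

Lemma limf_einf_gt0 (T : choiceType) (Y : filteredType T) (R : realType) (f : Y -> R)
    (G : set_system Y) : Filter G -> (0 < limf_einf (EFin \o f) G)%E ->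
  exists2 c, 0 < c & \forall x \near G, c <= f x.
Proof.
move=> FG; rewrite /limf_einf /limf_esup.
rewrite oppe_gt0 => /ereal_inf_lt[_ [V GV <-] sup0].
have [c c0 supc] : exists2 c : R, 0 < c &
    (ereal_sup [set ((\- (EFin \o f)) x)%E | x in V] <= (- c)%:E)%E.
  (* If the supremum is [-oo], any positive constant works, and 1 is taken. *)
  case: ereal_sup sup0 => [r|//|_]; last by exists 1; rewrite ?leNye.
  by rewrite lte_fin => r0; exists (- r); rewrite ?oppr_gt0 ?opprK.
exists c => //; apply: filterS GV => x Vx; rewrite -lerN2 -lee_fin.
by apply: le_trans supc; apply: ereal_sup_ubound; exists x.
Qed.

(** Beyond some [M] the condition at infinity gives the bound; on [[e, M]] local bounds become
    uniform by compactness. *)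
Lemma usc_gap (R : realType) (psi : R -> R) (e : R) :
    usc_on_nonneg psi -> (forall t, 0 < t -> psi t < t) ->
    (0 < limf_einf (fun t : R => (t - psi t)%:E) (pinfty_nbhs R))%E -> 0 < e ->
  exists2 c, 0 < c & forall t, e <= t -> c <= t - psi t.
Proof.
move=> usc lt_psi inf0 e0.
have [c1 c10 [M [_ gtM]]] := limf_einf_gt0 _ inf0.
have /compact_near_coveringP cover : compact `[e, M] by exact: segment_compact.
have gap : \forall c \near (0:R)^'+, `[e, M] `<=` [set t | c <= t - psi t].
  apply: cover => t /=; rewrite in_itv/= => /andP[et _].
  have t0 : 0 < t by exact: lt_le_trans et.
  (* As [t - psi t = 3 * b], the conditions [t - b < s] and [psi s < t - 2 * b] yield
     [b < s - psi s], so every [c <= b] works near [t]. *)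
  pose b := (t - psi t) / 3.
  have b0 : 0 < b by rewrite /b divr_gt0// subr_gt0 lt_psi.
  have psitb : psi t < t - 2 * b by have := lt_psi _ t0; rewrite /b; lra.
  have near_psi : \forall s \near t, psi s < t - 2 * b.
    (* Semicontinuity is relative to the half-line; at the interior point [t] its neighbourhoods are
       those of the real line. *)
    have t_int : (`[0, +oo[%classic : set R)° t.
      by rewrite interior_itv_bndy /= in_itv/= t0.
    by have := usc t _ psitb; rewrite /prop_near1 -(nbhs_subspace_interior t_int).
  have near_t : \forall s \near t, psi s < t - 2 * b /\ t - b < s.
    by near=> s; split; near: s; [exact: near_psi|apply: lt_nbhsr; lra].
  exists ([set s | psi s < t - 2 * b /\ t - b < s], [set c | c <= b]).
    by split=> //=; exact: nbhs_right_le.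
  by move=> [s c] /= [[? ?] ?]; lra.
have [c [[c0 cc1] {}gap]] :=
  filter_ex (filterI (filterI (nbhs_right_gt 0) (nbhs_right_le c10)) gap).
exists c => // t et; have [tM|Mt] := leP t M.
  by apply: gap; rewrite /= in_itv/= et.
exact: le_trans cc1 (gtM _ Mt).
Unshelve. all: by end_near. Qed.

Section fixed_point.
Context (R : realType) (X : pointedType) (d : X -> X -> R).
Context (dT0 : T0_quasi_pseudometric d) (F : X -> set X).
Context (F0 : forall x, F x !=set0).

Let almost_fixed (e : R) : set X := [set x | forall y, F x y -> dsym d x y < e].

Let dsym_ltP x y e : dsym d x y < e <-> d x y < e /\ d y x < e.
Proof. by rewrite /dsym gt_max; split=> /andP. Qed.

(* Going from [x] to [y] through [F x] and [F y] gives [d x y < psi (d x y) + 3 * c]. *)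
Lemma almost_fixed_close (psi : R -> R) (e c : R) x y :
    (hausdorff d (F x) (F y) <= (psi (d x y))%:E)%E ->
    (forall t, e <= t -> 3 * c <= t - psi t) -> 0 < c ->
  almost_fixed c x -> almost_fixed c y -> d x y < e.
Proof.
move=> Fxy gap c0 fx fy; have [[_ _ dtri] _] := dT0.
rewrite ltNge; apply/negP => /gap {}gap.
have [a Fa] := F0 x.
have [|b Fb ab] := hausdorff_le_fwd (s := psi (d x y) + c) Fxy _ Fa; first by lra.
have /dsym_ltP[xa _] := fx _ Fa; have /dsym_ltP[_ by_] := fy _ Fb.
by have := dtri x a y; have := dtri a b y; lra.
Qed.

(** The nested sets [almost_fixed e] generate a proper filter, Cauchy by the closeness assumption;
    each of them meets every ball around its limit. *)
Lemma almost_fixed_cvg :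
    (forall e, 0 < e -> exists2 c, 0 < c & forall x y,
       almost_fixed c x -> almost_fixed c y -> d x y < e) ->
    bicomplete dT0 -> (forall e, 0 < e -> almost_fixed e !=set0) ->
  exists x, forall e, 0 < e -> exists2 z, almost_fixed e z & dsym d x z < e.
Proof.
move=> close dbic fix_ex.
pose H : set_system (symspace dT0) := filter_from [set e : R | 0 < e] almost_fixed.
have fix_le a b : a <= b -> almost_fixed a `<=` almost_fixed b.
  by move=> ab x fx y /fx /lt_le_trans; exact.
have FH : Filter H.
  apply: filter_from_filter; first by exists 1; exact: ltr01.
  move=> a b a0 b0; exists (Num.min a b); first by rewrite /= lt_min; apply/andP.
  by move=> x fx; split; apply: fix_le fx; rewrite ge_min lexx ?orbT.
have PH : ProperFilter H by exact: (filter_from_proper FH fix_ex).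
have /(dbic _ PH) /cvg_ex[x Hx] : cauchy H.
  apply/cauchy_ballP => e e0; have [c c0 cl] := close _ e0.
  exists (almost_fixed c, almost_fixed c); first by split; exists c.
  move=> [y z] /= [fy fz]; rewrite ballEmdist /=.
  (* The closeness assumption is applied to both orders of the pair, which bounds [d] in both
     directions. *)
  by apply/dsym_ltP; split; exact: cl.
exists x => e e0.
have He : H (almost_fixed e) by exists e.
have Hb : H (ball x e) by apply: Hx; exact: nbhsx_ballx.
have [z [fz]] := filter_ex (filterI He Hb).
by rewrite ballEmdist; exists z.
Qed.

(** A point [y] of [F x] is joined to [x] in both directions by paths through [F z] and [z], with
    [z] almost fixed and near [x]. *)
Lemma limit_almost_fixed_fixed x :
    (forall y z, (hausdorff d (F y) (F z) <= (d y z)%:E)%E) ->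
    (forall e, 0 < e -> exists2 z, almost_fixed e z & dsym d x z < e) ->
  F x = [set x].
Proof.
move=> FH lim; have [[d0 _ dtri] dsep] := dT0.
have Fx y : F x y -> x = y.
  move=> Fxy.
  have small e : 0 < e -> d x y <= e /\ d y x <= e.
    move=> e0; have e40 : 0 < e / 4 by lra.
    have [z fz /dsym_ltP[xz zx]] := lim _ e40.
    have [|a Fa ay] := hausdorff_le_bwd (s := d z x + e / 4) (FH z x) _ Fxy; first by lra.
    have [|b Fb yb] := hausdorff_le_fwd (s := d x z + e / 4) (FH x z) _ Fxy; first by lra.
    have /dsym_ltP[za _] := fz _ Fa; have /dsym_ltP[_ bz] := fz _ Fb.
    have := dtri x z y; have := dtri z a y; have := dtri y b x; have := dtri b z x.
    by split; lra.
  apply: dsep; apply/eqP; rewrite eq_le d0 andbT; apply/ler_addgt0Pl => e /small[];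
    by rewrite addr0.
apply/seteqP; split=> [y /Fx ->//|_ ->].
by have [y Fxy] := F0 x; rewrite {2}(Fx _ Fxy).
Qed.

End fixed_point.

(* psi 0 = 0 is not automatic from psi t < t on ]0, +oo[, and without it the
   equivalence fails, because d x y = 0 does not force x = y *)
Theorem theorem29 (R : realType) (X : pointedType) (d : X -> X -> R)
    (dT0 : T0_quasi_pseudometric d) (dbic : bicomplete dT0)
    (F : X -> set X) (FCB : forall x, CB dT0 (F x))
    (psi : R -> R)
    (psi_ge0 : forall t, 0 <= t -> 0 <= psi t)
    (psi0 : psi 0 = 0)
    (psi_usc : usc_on_nonneg psi)
    (psi_lt : forall t, 0 < t -> psi t < t)
    (psi_liminf : (0 < limf_einf (fun t : R => (t - psi t)%:E) (pinfty_nbhs R))%E)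
    (FH : forall x y, (hausdorff d (F x) (F y) <= (psi (d x y))%:E)%E) :
  (exists! x0 : X, startpoint d F x0 /\ endpoint d F x0) <->
  approx_mix_point d F.
Proof.
have [[d0 dxx dtri] dsep] := dT0.
have F0 x : F x !=set0 by have [] := FCB x.
have fixP x := start_endpointP dT0 (F0 x).
split=> [[x [/fixP Fx _]]|Fmix].
  exact: fixed_approx_mix_point dT0.1 F0 Fx.
have [||x lim] := almost_fixed_cvg (F := F) _ dbic.
- move=> e e0; have [c c0 gap] := usc_gap psi_usc psi_lt psi_liminf e0.
  (* The path through [F x] and [F y] loses three times the constant, hence [c / 3]. *)
  have c30 : 0 < c / 3 by lra.
  exists (c / 3) => // x y; apply: almost_fixed_close (FH x y) _ c30 => //.
  by move=> t /gap; lra.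
- by move=> e; exact: approx_mix_point_ex.
have Fx : F x = [set x].
  apply: (limit_almost_fixed_fixed dT0 F0) lim => y z.
  apply: le_trans (FH y z) _; rewrite lee_fin.
  (* Nonexpansiveness at distance 0 comes from [psi0], elsewhere from [psi_lt]. *)
  by have := d0 y z; rewrite le_eqVlt => /predU1P[<-|/psi_lt/ltW//]; rewrite psi0.
exists x; split=> [|y /fixP Fy]; first exact/fixP.
(* For two fixed singletons [d u v <= psi (d u v)], which [psi_lt] excludes at positive distance. *)
have dist0 u v : F u = [set u] -> F v = [set v] -> d u v = 0.
  move=> Fu Fv; have := FH u v; rewrite Fu Fv hausdorff_set1 lee_fin.
  by have := d0 u v; rewrite le_eqVlt => /predU1P[<-//|/psi_lt]; lra.
by apply: dsep; exact: dist0.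
Qed.
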